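(* Let $A$ be an integral domain and $E$ a torsion free $A$-module. Then $E$ is a divisible $A$-module if and only if $qD_A(E)$ is a Noetherian space.
   Context: For an $A$-module $E$: $\operatorname{ann}(E)=\{a\in A: aE=0\}$, $W(E)=\{a\in A: aE\neq E\}$, $W(E)^{\#}=W(E)\setminus\operatorname{ann}(E)$. On $W(E)^{\#}$ put $a\sim b$ iff $aE=bE$; $[a]$ is the class of $a$ and $\operatorname{EC}(W(E)^{\#})$ is the set of all classes. For $a\in W(E)^{\#}$, $U_a=\{[b]\in\operatorname{EC}(W(E)^{\#}): aE\subseteq bE\}$. The quasi divisor topology $qD_A(E)$ is the topological space $\operatorname{EC}(W(E)^{\#})$ whose topology has basis $\{U_a\}_{a\in W(E)^{\#}}$ (possibly the empty space). $E$ is divisible if $aE=E$ for every nonzero $a\in A$. A topological space is Noetherian if its closed subsets satisfy the descending chain condition (equivalently, there is no strictly increasing infinite chain of open subsets). *)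

(* Defs.v *)
From HB Require Import structures.
From mathcomp Require Import all_boot all_order all_algebra generic_quotient.
From mathcomp Require Import all_classical topology.

Set Implicit Arguments.
Unset Strict Implicit.
Unset Printing Implicit Defensive.

Import GRing.Theory.

Local Open Scope classical_set_scope.
Local Open Scope ring_scope.
Local Open Scope quotient_scope.

Section QuasiDivisorTopology.
Context (A : comPzRingType) (E : lmodType A).

Definition smul_mod (a : A) : set E := [set a *: x | x in [set: E]].

Definition ann : set A := [set a | smul_mod a = [set 0]].

Definition W : set A := [set a | smul_mod a <> [set: E]].

Definition Wsharp : set A := W `\` ann.

(* a ~ b iff aE = bE, made boolean by [asbool] as [{eq_quot _}] requires. *)
Definition sim (a b : Wsharp) : bool := `[< smul_mod (val a) = smul_mod (val b) >].

Lemma sim_refl : reflexive sim.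
Proof. by move=> a; apply/asboolP. Qed.

Lemma sim_sym : symmetric sim.
Proof. by move=> a b; apply/asboolP/asboolP => ->. Qed.

Lemma sim_trans : transitive sim.
Proof. by move=> b a c /asboolP ab /asboolP bc; apply/asboolP; rewrite ab. Qed.

Canonical sim_equiv := EquivRel sim sim_refl sim_sym sim_trans.

Definition EC : Type := {eq_quot sim}.

HB.instance Definition _ := Choice.on EC.
HB.instance Definition _ := EqQuotient.on EC.

Definition U (a : Wsharp) : set EC :=
  [set \pi_EC b | b in [set b : Wsharp | smul_mod (val a) `<=` smul_mod (val b)]].

Lemma U_pi (a b : Wsharp) :
  U a (\pi_EC b) <-> smul_mod (val a) `<=` smul_mod (val b).
Proof.
split=> [[c /= ac /eqquotP /asboolP <- //]|ab]; by exists b.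
Qed.

Definition qD : Type := EC.

HB.instance Definition _ := Choice.on qD.
HB.instance Definition _ := EqQuotient.on qD.

Definition qD_basis : set (set qD) := [set U a | a in [set: Wsharp]].

Lemma qD_basis_cover : \bigcup_(B in qD_basis) B = [set: qD].
Proof.
apply/seteqP; split=> // t _; exists (U (repr t)); first by exists (repr t).
by rewrite -{2}[t]reprK; apply/U_pi.
Qed.

Lemma qD_basis_join (B C : set qD) (t : qD) : qD_basis B -> qD_basis C ->
  B t -> C t -> exists D, [/\ qD_basis D, D t & D `<=` B `&` C].
Proof.
move=> [a _ <-] [b _ <-]; rewrite -[t]reprK => /U_pi ac /U_pi bc.
exists (U (repr t)); split; [by exists (repr t)|exact/U_pi|].
move=> s; rewrite -[s]reprK => /U_pi cs.
by split; apply/U_pi; apply: subset_trans cs.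
Qed.

(* The open sets are the unions of subfamilies of [qD_basis]. *)
HB.instance Definition _ :=
  isBaseTopological.Build qD qD_basis_cover qD_basis_join.

Definition divisible : Prop := forall a : A, a <> 0 -> smul_mod a = [set: E].

Definition torsion_free : Prop :=
  forall (a : A) (x : E), a *: x = 0 -> a = 0 \/ x = 0.

End QuasiDivisorTopology.

Definition noetherian_space (T : topologicalType) : Prop :=
  forall C : nat -> set T,
    (forall n, closed (C n)) -> (forall n, C n.+1 `<=` C n) ->
    exists N, forall n, (N <= n)%N -> C n = C N.

(* Main.v *)
Require Import Defs.
From mathcomp Require Import all_boot all_order all_algebra.
From mathcomp Require Import all_classical topology.

(** If [E] is divisible, every [a] with [aE <> E] is zero, hence annihilates
    [E]: the space has no points at all, and is trivially Noetherian.

    Conversely, let [a] be nonzero with [aE <> E].  On a torsion free module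
    multiplication by a nonzero [b] is injective, so an inclusion of [bE] in
    [baE] can be cancelled to [aE = E] ([smul_mod_cancel]).  Applied to
    [b = a ^+ n], this makes the chain [aE, a^2 E, a^3 E, ...] strictly
    decreasing.  None of these powers annihilates [E] and none of them acts
    surjectively ([Wsharp_exp]), so each gives a point of the space.  The basic
    open set [U b] grows when [bE] shrinks, and [U b] always contains the class
    of [b]; the sets [U (a ^+ n.+1)] thus form a strictly increasing chain of
    open sets, whose complements violate the descending chain condition. *)

Set Implicit Arguments.
Unset Strict Implicit.
Unset Printing Implicit Defensive.

Import GRing.Theory.

Local Open Scope classical_set_scope.
Local Open Scope ring_scope.
Local Open Scope quotient_scope.

Lemma open_U (A : comPzRingType) (E : lmodType A) (a : Wsharp E) :
  open (U a : set (qD E)).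
Proof.
exists [set (U a : set (qD E))]; last by rewrite bigcup_set1.
by move=> _ ->; exists a.
Qed.

Lemma ann0 (A : comPzRingType) (E : lmodType A) : ann E 0.
Proof.
apply/seteqP; split=> [_ [x _ <-]|_ ->] /=; first by rewrite scale0r.
by exists 0; rewrite ?scale0r.
Qed.

Lemma smul_modM (A : comPzRingType) (E : lmodType A) (b a : A) :
  (smul_mod (b * a) : set E) `<=` smul_mod b.
Proof. by move=> _ [x _ <-]; exists (a *: x); rewrite // scalerA. Qed.

(** Writing [b *: x = b *: (a *: y)] and cancelling the nonzero scalar [b]
    exhibits an arbitrary [x] as a multiple of [a]. *)
Lemma smul_mod_cancel (A : comPzRingType) (E : lmodType A) (b a : A) :
  torsion_free E -> b <> 0 ->
  (smul_mod b : set E) `<=` smul_mod (b * a) -> smul_mod a = [set: E].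
Proof.
move=> tfE b_neq0 sub; apply/seteqP; split=> // x _.
have [|y _ baxE] := sub (b *: x); first by exists x.
have /tfE [//|/eqP] : b *: (a *: y - x) = 0.
  by rewrite scalerBr scalerA baxE subrr.
by rewrite subr_eq0 => /eqP <-; exists y.
Qed.

(** For [n >= 1], [a^n E] is contained in [aE], hence proper; if it were zero,
    then [E] itself would be zero by torsion freeness, forcing [aE = E]. *)
Lemma Wsharp_exp (A : idomainType) (E : lmodType A) (a : A) (n : nat) :
  torsion_free E -> a <> 0 -> W E a -> Wsharp E (a ^+ n.+1).
Proof.
move=> tfE /eqP a_neq0 aEN.
split=> [anE|anE]; apply: aEN; apply/seteqP; split=> // x _.
  by have : smul_mod (a ^+ n.+1) x; [rewrite anE|rewrite exprS => /smul_modM].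
have : smul_mod (a ^+ n.+1) (a ^+ n.+1 *: x) by exists x.
rewrite anE => /= /tfE [/eqP|->]; last by exists 0; rewrite ?scaler0.
by rewrite (negPf (expf_neq0 _ a_neq0)).
Qed.

Lemma noetherian_divisible (A : idomainType) (E : lmodType A) :
  torsion_free E -> noetherian_space (qD E) -> divisible E.
Proof.
move=> tfE noeth a a_neq0; apply: contrapT => aEN.
(* The exponent starts at 1 because [a ^+ 0 = 1] acts surjectively. *)
pose p n : Wsharp E :=
  exist (fun x => x \in Wsharp E) _ (mem_set (Wsharp_exp n tfE a_neq0 aEN)).
have [n|n|N /(_ N.+1 (leqnSn N)) stable] :=
  noeth (fun n => ~` (U (p n) : set (qD E))).
- by apply: open_closedC; apply: open_U.
- apply: subsetC => s; rewrite -[s]reprK => /U_pi sub; apply/U_pi.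
  by apply: subset_trans sub; rewrite /= exprSr; apply: smul_modM.
(* The class of [a ^+ N.+2] lies in [U (a ^+ N.+2)], so by stability it lies
   in [U (a ^+ N.+1)] as well. *)
- have /U_pi : U (p N) (\pi_(EC E) (p N.+1)).
    by move/setC_inj: stable => <-; apply/U_pi.
  rewrite /= (exprSr a N.+1) => sub.
  apply/aEN; apply: (smul_mod_cancel tfE _ sub).
  by apply/eqP/expf_neq0/eqP.
Qed.

Lemma divisible_noetherian (A : comPzRingType) (E : lmodType A) :
  divisible E -> noetherian_space (qD E).
Proof.
move=> divE.
have empty (s : qD E) : False.
  have /set_mem [aW aN] := valP (repr s); apply: aW; apply: divE => a0.
  by apply: aN; rewrite a0; apply: ann0.
by move=> C _ _; exists 0%N => n _; apply/seteqP; split=> s; case: (empty s).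
Qed.

Theorem proposition3 (A : idomainType) (E : lmodType A)
    (tfE : torsion_free E) :
  divisible E <-> noetherian_space (qD E).
Proof.
split; [exact: divisible_noetherian|exact: noetherian_divisible].
Qed.
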